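(* Let $X$ and $Y$ be complex topological vector spaces, let $\Gamma\subset L(X)$ and $\Gamma_1\subset L(Y)$, and assume that $\Gamma$ and $\Gamma_1$ are quasi-similar via a map $\phi: X\to Y$. If $\Gamma$ is codiskcyclic in $X$, then $\Gamma_1$ is codiskcyclic in $Y$. Moreover, $\phi(\mathbb{U}C(\Gamma))\subset \mathbb{U}C(\Gamma_1)$.
   Context: For a complex topological vector space $X$, $L(X)$ is the set of all continuous linear operators on $X$. Put $\mathbb{U}=\{\alpha\in\mathbb{C} : |\alpha|\geq 1\}$. For $\Gamma\subset L(X)$ and $x\in X$, the codisk orbit of $x$ under $\Gamma$ is $\mathbb{U}Orb(\Gamma,x)=\{\alpha Tx : \alpha\in\mathbb{U},\ T\in\Gamma\}$. The vector $x$ is a codiskcyclic vector for $\Gamma$ if $\mathbb{U}Orb(\Gamma,x)$ is dense in $X$; the set of all codiskcyclic vectors for $\Gamma$ is denoted $\mathbb{U}C(\Gamma)$, and $\Gamma$ is codiskcyclic if $\mathbb{U}C(\Gamma)\neq\emptyset$. $\Gamma\subset L(X)$ and $\Gamma_1\subset L(Y)$ are called quasi-similar (via $\phi$) if there exists a continuous map $\phi: X\to Y$ with dense range such that for all $T\in\Gamma$ there exists $S\in\Gamma_1$ satisfying $S\circ\phi=\phi\circ T$.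
   Formalization: The map φ is additionally assumed homogeneous, φ(αx) = αφ(x) for all complex α (as holds for every linear φ); for a merely continuous map φ with dense range the claim is false. *)

(* Defs.v *)
From HB Require Import structures.
From mathcomp Require Import all_boot all_order all_algebra.
From mathcomp Require Import complex.
From mathcomp Require Import boolp classical_sets reals topology tvs.

Set Implicit Arguments.
Unset Strict Implicit.
Unset Printing Implicit Defensive.

Import Order.TTheory GRing.Theory Num.Theory.
Local Open Scope classical_set_scope.
Local Open Scope ring_scope.

(* A complex topological vector space is a [topologicalLmodType R[i]] with
   [R : realType]: addition and scaling are jointly continuous, with neither
   local convexity nor separation assumed. *)

Section Codiskcyclic.
Variables (R : realType) (X : topologicalLmodType R[i]).

Definition continuous_operators : set {linear X -> X} :=
  [set T | continuous (T : X -> X)].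

(* The norm of [R[i]] takes its values in [R[i]], on the real axis. *)
Definition codisk : set R[i] := [set a | 1 <= `|a|].

Definition codisk_orbit (Gamma : set {linear X -> X}) (x : X) : set X :=
  [set y | exists a : R[i], exists T : {linear X -> X},
     [/\ codisk a, Gamma T & y = a *: T x]].

Definition codiskcyclic_vectors (Gamma : set {linear X -> X}) : set X :=
  [set x | dense (codisk_orbit Gamma x)].

Definition codiskcyclic (Gamma : set {linear X -> X}) : Prop :=
  codiskcyclic_vectors Gamma !=set0.

End Codiskcyclic.

(* [phi] is not assumed linear or even homogeneous here. Transferring
   codiskcyclicity along [phi] does need homogeneity: with X = C, Y = C^2 and
   Gamma, Gamma1 the homotheties of ratio t in ]0, 1], the map
   phi z = |z| f (z / |z|), f a continuous surjection from the unit circle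
   onto the unit sphere of C^2, makes Gamma and Gamma1 quasi-similar; Gamma is
   codiskcyclic and Gamma1 is not. *)
Definition quasi_similar_via (R : realType) (X Y : topologicalLmodType R[i])
    (Gamma : set {linear X -> X}) (Gamma1 : set {linear Y -> Y})
    (phi : X -> Y) : Prop :=
  [/\ continuous phi, dense (range phi) &
      forall T : {linear X -> X}, Gamma T ->
        exists2 S : {linear Y -> Y}, Gamma1 S & S \o phi = phi \o T].

(* Main.v *)
Require Import Defs.
From mathcomp Require Import all_boot all_order all_algebra.
From mathcomp Require Import complex.
From mathcomp Require Import boolp classical_sets reals topology tvs.
Local Open Scope classical_set_scope.
Local Open Scope ring_scope.

(** If [x] is codiskcyclic for [Gamma], its codisk orbit is dense in [X], and a
    continuous map with dense range carries dense sets to dense sets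
    ([dense_image]); so the image under [phi] of that orbit is dense in [Y].
    Homogeneity of [phi] and the relation [S \o phi = phi \o T] give
    [phi (a *: T x) = a *: S (phi x)], hence this image lies in the codisk orbit
    of [phi x] under [Gamma1] ([image_codisk_orbit]), which is therefore dense
    as well. *)

Lemma subset_dense {T : topologicalType} {A B : set T} :
  A `<=` B -> dense A -> dense B.
Proof.
move=> AB dA O O0 oO; have [y [Oy Ay]] := dA O O0 oO.
by exists y; split=> //; exact: AB.
Qed.

(** Density of the range makes the preimage of a nonempty open set nonempty, and
    continuity makes it open, so it meets every dense set. *)
Lemma dense_image {T U : topologicalType} {f : T -> U} {A : set T} :
  continuous f -> dense (range f) -> dense A -> dense (f @` A).
Proof.
move=> /continuousP cf df dA O O0 oO.
have [y0 [Oy0 [z _ fz]]] := df O O0 oO.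
have [|y [Oy Ay]] := dA (f @^-1` O) _ (cf O oO).
  by exists z; rewrite /preimage /= fz.
by exists (f y); split=> //; exists y.
Qed.

Lemma image_codisk_orbit {R : realType} {X Y : topologicalLmodType R[i]}
    {Gamma : set {linear X -> X}} {Gamma1 : set {linear Y -> Y}}
    {phi : X -> Y} (x : X) :
  scalable phi -> quasi_similar_via Gamma Gamma1 phi ->
  phi @` codisk_orbit Gamma x `<=` codisk_orbit Gamma1 (phi x).
Proof.
move=> phi_hom [_ _ sim] _ [_ [a [T [a1 GT ->]] <-]].
have [S GS SphiT] := sim T GT.
exists a, S; split=> //.
by rewrite phi_hom -[S (phi x)]/((S \o phi) x) SphiT.
Qed.

Theorem proposition2p6 (R : realType) (X Y : topologicalLmodType R[i])
    (Gamma : set {linear X -> X}) (Gamma1 : set {linear Y -> Y})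
    (phi : X -> Y)
    (Gamma_cont : Gamma `<=` continuous_operators (X := X))
    (Gamma1_cont : Gamma1 `<=` continuous_operators (X := Y))
    (phi_hom : scalable phi)
    (phi_qs : quasi_similar_via Gamma Gamma1 phi) :
  (codiskcyclic Gamma -> codiskcyclic Gamma1) /\
  phi @` codiskcyclic_vectors Gamma `<=` codiskcyclic_vectors Gamma1.
Proof.
have vecs : phi @` codiskcyclic_vectors Gamma `<=` codiskcyclic_vectors Gamma1.
  move=> _ [x dx <-].
  have [cphi dphi _] := phi_qs.
  exact: subset_dense (image_codisk_orbit x phi_hom phi_qs)
                      (dense_image cphi dphi dx).
split=> // -[x cx].
by exists (phi x); apply: vecs; exists x.
Qed.
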